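(* Let $\mathbb{H}=\{(x,y)\in\mathbb{R}^2: y>0\}$, let $(x^v,x^u)$ be Cartesian coordinates on $\mathbb{R}^2$, and let $\lambda\in\mathbb{R}\setminus\{0\}$. For every function $\mathcal{F}\in C^\infty(\mathbb{H})$, the Lorentzian metric on $\mathbb{R}^2\times\mathbb{H}$ given by $$\mathrm{d}s^2_g=\mathcal{F}\,(\mathrm{d}x^v)^2+\frac{\mathrm{d}x^v\,\mathrm{d}x^u}{y^2}+\frac{(\mathrm{d}x)^2+(\mathrm{d}y)^2}{\lambda^2y^2}$$ admits nontrivial real Killing spinors (with Killing constant $\frac{\lambda}{2}$). Moreover, this metric is Einstein with Einstein constant $\Lambda=-3\lambda^2$ whenever $\mathcal{F}$ has one of the forms $$\mathcal{F}=(a_1+a_2x)\Big(a_3y+\frac{a_4}{y^2}\Big)\qquad\text{or}\qquad \mathcal{F}=(a_1e^{cx}+a_2e^{-cx})\big[a_3\,\mathrm{BY}(cy)+a_4\,\mathrm{BJ}(cy)\big],$$ where $a_1,\dots,a_4\in\mathbb{R}$ and $c\in\mathbb{R}\setminus\{0\}$.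
   Context: $\mathrm{BJ}$ and $\mathrm{BY}$ are the spherical Bessel functions $\mathrm{BJ}(z)=\frac{\sin z}{z^2}-\frac{\cos z}{z}$ and $\mathrm{BY}(z)=-\frac{\cos z}{z^2}-\frac{\sin z}{z}$. Here $\mathrm{d}x^v\mathrm{d}x^u$ denotes the symmetric product, so $g(\partial_{x^v},\partial_{x^u})=\frac{1}{2y^2}$. Einstein with constant $\Lambda$ means $\mathrm{Ric}^g=\Lambda g$. The real spinor bundle $S$ of a spin Lorentzian four-manifold of signature $(3,1)$ is the rank 4 bundle of irreducible real modules over the Clifford bundle of $(T^*M,g^* )$, with convention $\theta^2=+g^*(\theta,\theta)$, associated to the spin structure. $\nabla^S$ is the lift of the Levi-Civita connection. A real Killing spinor with Killing constant $\frac{\lambda}{2}$ is a section $\epsilon\in\Gamma(S)$ with $\nabla^S_X\epsilon=\frac{\lambda}{2}X^\flat\cdot\epsilon$ for all vector fields $X$; nontrivial means not identically zero. *)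

(* Defs.v *)
From HB Require Import structures.
From mathcomp Require Import all_boot all_order all_algebra.
From mathcomp Require Import all_classical all_reals all_analysis.
Set Implicit Arguments.
Unset Strict Implicit.
Unset Printing Implicit Defensive.
Import Order.TTheory GRing.Theory Num.Theory.
Import numFieldNormedType.Exports.
Local Open Scope classical_set_scope.
Local Open Scope ring_scope.

Section Calculus.
Variables (R : realType) (n : nat).
Implicit Types (U : set 'rV[R]_n.+1) (f : 'rV[R]_n.+1 -> R).

Definition partial (i : 'I_n.+1) f (p : 'rV[R]_n.+1) : R :=
  'D_(delta_mx 0 i) f p.

(* Intended for open U, where it is the usual notion of a C^k function. *)
Fixpoint Ck_on (k : nat) U f : Prop :=
  (forall p, U p -> {for p, continuous f}) /\
  (if k is k'.+1 then
     forall i, (forall p, U p -> derivable f p (delta_mx 0 i)) /\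
               Ck_on k' U (partial i f)
   else True).

Definition smooth_on U f : Prop := forall k, Ck_on k U f.

End Calculus.

(* Tensor calculus in the coordinates of an open subset of R^4; a metric is
   given by the matrix field p |-> (g_ij(p)). *)
Section Curvature.
Variable R : realType.
Implicit Types (g : 'rV[R]_4 -> 'M[R]_4) (p : 'rV[R]_4).

(* christoffel g k i j p is \Gamma^k_{ij}(p). *)
Definition christoffel g (k i j : 'I_4) p : R :=
  2^-1 * \sum_l invmx (g p) k l *
    (partial i (fun q => g q j l) p + partial j (fun q => g q i l) p
     - partial l (fun q => g q i j) p).

(* riemann g l k i j p is dx^l(R(d_i, d_j) d_k), where
   R(X, Y) = [nabla_X, nabla_Y] - nabla_[X, Y]. *)
Definition riemann g (l k i j : 'I_4) p : R :=
  partial i (christoffel g l j k) p - partial j (christoffel g l i k) p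
  + \sum_m (christoffel g l i m p * christoffel g m j k p
            - christoffel g l j m p * christoffel g m i k p).

(* Ric(Y, Z) = tr (X |-> R(X, Y) Z). *)
Definition ricci g p : 'M[R]_4 :=
  \matrix_(j, k) \sum_i riemann g i k i j p.

Definition einstein_on (U : set 'rV[R]_4) g (Lambda : R) : Prop :=
  forall p, U p -> ricci g p = Lambda *: g p.

End Curvature.

Section Spinors.
Variable R : realType.

(* Signature (3,1); the time direction has index 0. *)
Definition eta : 'M[R]_4 :=
  diag_mx (\row_(a < 4) (if a == 0 then -1 else 1)).

(* Row a of the matrix e p lists the components of the covector e^a at p. *)
Definition orthonormal_coframe (U : set 'rV[R]_4)
    (g e : 'rV[R]_4 -> 'M[R]_4) : Prop :=
  (forall a i, smooth_on U (fun p => e p a i)) /\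
  (forall p, U p -> g p = (e p)^T *m eta *m e p).

(* An irreducible real module R^4 (column vectors) of the Clifford algebra of
   (R^{3,1})^*, with theta^2 = + g^*(theta, theta): gamma a is the action of
   the a-th covector of an orthonormal basis.  A subspace is encoded as the row
   space of V, whence the transposes. *)
Definition irreducible_clifford_module (gamma : 'I_4 -> 'M[R]_4) : Prop :=
  (forall a b, gamma a *m gamma b + gamma b *m gamma a = (2 * eta a b)%:M) /\
  (forall V : 'M[R]_4,
     (forall a, stablemx V (gamma a)^T) -> V = 0 \/ row_full V).

(* The spinor bundle of a spin structure on (U, g), trivialized by a global
   section of the spin frame bundle lying over the orthonormal coframe e:
   sections are maps U -> R^4 and e^a acts by the constant matrix gamma a.
   On a contractible U the spin structure is unique and trivial, and every
   orthonormal coframe lifts to it; as moreover all irreducible real modules of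
   the Clifford algebra M_4(R) of signature (3,1) are isomorphic, any two such
   bundles are isomorphic together with Clifford action and connection. *)
Record spinor_bundle (U : set 'rV[R]_4) (g : 'rV[R]_4 -> 'M[R]_4) := {
  coframe : 'rV[R]_4 -> 'M[R]_4;
  gamma : 'I_4 -> 'M[R]_4;
  coframeP : orthonormal_coframe U g coframe;
  gammaP : irreducible_clifford_module gamma
}.

(* Connection forms \omega^a_b(d_i) of the Levi-Civita connection in the frame
   (E_b) dual to (e^a), nabla_X E_b = \omega^a_b(X) E_a, equivalently
   nabla_X e^a = - \omega^a_b(X) e^b; the columns of invmx (e p) are the E_b. *)
Definition connection_form (g e : 'rV[R]_4 -> 'M[R]_4) (i a b : 'I_4)
    (p : 'rV[R]_4) : R :=
  - \sum_j (partial i (fun q => e q a j) p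
            - \sum_k christoffel g k i j p * e p a k) * invmx (e p) j b.

Variables (U : set 'rV[R]_4) (g : 'rV[R]_4 -> 'M[R]_4).
Variable S : spinor_bundle U g.
Implicit Types (eps : 'rV[R]_4 -> 'cV[R]_4) (p X : 'rV[R]_4).

(* nabla^S_X eps = X(eps) + 1/4 \omega_{ab}(X) gamma^a gamma^b eps, at p, with
   \omega_{ab} = eta_{aa} \omega^a_b since eta is diagonal. *)
Definition spinor_nabla eps p X : 'cV[R]_4 :=
  \sum_i X 0 i *:
    (\col_s partial i (fun q => eps q s 0) p
     + 4^-1 *: \sum_a \sum_b
         (eta a a * connection_form g (coframe S) i a b p)
           *: (gamma S a *m gamma S b *m eps p)).

(* X^flat . eps, where X^flat = g(X, .) = eta_{aa} e^a(X) e^a. *)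
Definition flat_clifford p X (s : 'cV[R]_4) : 'cV[R]_4 :=
  \sum_a (eta a a * \sum_i coframe S p a i * X 0 i) *: (gamma S a *m s).

Definition killing_spinor (kappa : R) eps : Prop :=
  (forall s, smooth_on U (fun p => eps p s 0)) /\
  (forall p X, U p ->
     spinor_nabla eps p X = kappa *: flat_clifford p X (eps p)).

End Spinors.

Definition admits_nontrivial_killing_spinor (R : realType)
    (U : set 'rV[R]_4) (g : 'rV[R]_4 -> 'M[R]_4) (kappa : R) : Prop :=
  exists (S : spinor_bundle U g) (eps : 'rV[R]_4 -> 'cV[R]_4),
    killing_spinor S kappa eps /\ exists2 p, U p & eps p != 0.

Section Metric.
Variable R : realType.

(* Points of R^2 are rows (x, y), points of R^4 are rows (x^v, x^u, x, y). *)
Definition half_plane : set 'rV[R]_2 := [set q | 0 < q 0 (inord 1)].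

Definition half_plane_part (p : 'rV[R]_4) : 'rV[R]_2 :=
  \row_(i < 2) p 0 (inord (i + 2)%N).

(* The manifold R^2 x H. *)
Definition spacetime : set 'rV[R]_4 :=
  [set p | half_plane (half_plane_part p)].

(* F (dx^v)^2 + dx^v dx^u / y^2 + ((dx)^2 + (dy)^2) / (lambda^2 y^2); the
   products are symmetric, so g_{vu} = g_{uv} = 1 / (2 y^2). *)
Definition metric (lambda : R) (F : 'rV[R]_2 -> R) (p : 'rV[R]_4) : 'M[R]_4 :=
  let q := half_plane_part p in
  let y := q 0 (inord 1) in
  \matrix_(i < 4, j < 4)
    match val i, val j with
    | 0%N, 0%N => F q
    | 0%N, 1%N | 1%N, 0%N => (2 * y ^+ 2)^-1
    | 2%N, 2%N | 3%N, 3%N => (lambda ^+ 2 * y ^+ 2)^-1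
    | _, _ => 0
    end.

Definition BJ (z : R) : R := sin z / z ^+ 2 - cos z / z.
Definition BY (z : R) : R := - (cos z / z ^+ 2) - sin z / z.

Definition rational_form (a1 a2 a3 a4 : R) (q : 'rV[R]_2) : R :=
  let x := q 0 (inord 0) in let y := q 0 (inord 1) in
  (a1 + a2 * x) * (a3 * y + a4 / y ^+ 2).

Definition bessel_form (a1 a2 a3 a4 c : R) (q : 'rV[R]_2) : R :=
  let x := q 0 (inord 0) in let y := q 0 (inord 1) in
  (a1 * expR (c * x) + a2 * expR (- (c * x)))
  * (a3 * BY (c * y) + a4 * BJ (c * y)).

End Metric.

(* Main.v *)
Require Import Defs.
From HB Require Import structures.
From mathcomp Require Import all_boot all_order all_algebra.
From mathcomp Require Import all_classical all_reals all_analysis.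
From mathcomp Require Import ring.
Set Implicit Arguments.
Unset Strict Implicit.
Unset Printing Implicit Defensive.
Import Order.TTheory GRing.Theory Num.Theory.
Import numFieldNormedType.Exports.
Local Open Scope classical_set_scope.
Local Open Scope ring_scope.

(** Write y for the last coordinate and [F] for the profile function.

    Killing spinors.  The metric is (e^1)^2 - (e^0)^2 + (e^2)^2 + (e^3)^2 for
    the coframe with e^1 + e^0 = dx^v / y^2, e^1 - e^0 = y^2 F dx^v + dx^u,
    e^2 = dx / (lambda y) and e^3 = dy / (lambda y).  The terms of the
    connection by which F departs from anti-de Sitter space (F = 0) are null
    rotations that fix the covector e^1 + e^0, and these annihilate every
    spinor killed by e^1 + e^0.  Among such spinors, those on which e^3 acts as
    -1 are the usual Poincare-patch Killing spinors of anti-de Sitter space.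
    They scale as y^(-1/2) in the frame proportional to the coordinate frame;
    the boost by y that distinguishes the coframe above compensates this
    factor, so here the Killing spinor has constant components
    ([basic_spinor_killing]).  In the real representation [majorana] of the
    Clifford algebra it is a vector of the standard basis, and the Killing
    equation becomes an identity between rational functions of y, F and the
    first derivatives of F ([killing_equation_coordinate]).

    Einstein equation.  All metric components depend on the half plane
    variables only, so the Christoffel symbols and their derivatives are
    explicit ([christoffelE], [partial_christoffel_coef]).  The Ricci tensor
    equals -3 lambda^2 g except for its vv component, which satisfies
      Ric_vv + 3 lambda^2 F
        = - lambda^2 / 2 (y^2 (F_xx + F_yy) + 2 y F_y - 2 F).
    Thus a linear equation for F remains ([einstein_equation]).  It separates:
    X(x) Y(y) is a solution if X'' = k X and y^2 Y'' + 2 y Y' = (2 - k y^2) Y.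
    For k = 0 the latter is the Euler equation solved by y and y^(-2), for
    k = c^2 it is the spherical Bessel equation of order one in c y. *)

(** * Derivatives *)

(** The same proposition as [is_derive], but not a class: applying the rules
    below then leaves the derivatives of subexpressions as plain goals instead
    of starting an instance search on them. *)
Definition has_deriv (R : realType) (V : normedModType R) (f : V -> R)
  (x v : V) (a : R) : Prop := is_derive x v f a.

Section DerivativeRules.
Variables (R : realType) (V : normedModType R).
Implicit Types (f g : V -> R) (x v : V) (a b c : R).

Lemma has_deriv_eq f x v a b : has_deriv f x v a -> a = b -> has_deriv f x v b.
Proof. by move=> df <-. Qed.

Lemma has_deriv_val f x v a : has_deriv f x v a -> 'D_v f x = a.
Proof. by case. Qed.

Lemma has_deriv_const c x v : has_deriv (fun=> c) x v 0.
Proof. exact: is_derive_cst. Qed.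

Lemma has_deriv_add f g x v a b : has_deriv f x v a -> has_deriv g x v b ->
  has_deriv (fun z => f z + g z) x v (a + b).
Proof. exact: is_deriveD. Qed.

Lemma has_deriv_opp f x v a : has_deriv f x v a ->
  has_deriv (fun z => - f z) x v (- a).
Proof. exact: is_deriveN. Qed.

Lemma has_deriv_mul f g x v a b : has_deriv f x v a -> has_deriv g x v b ->
  has_deriv (fun z => f z * g z) x v (a * g x + f x * b).
Proof.
by move=> df dg; have := is_deriveM df dg; rewrite addrC [g x *: _]mulrC.
Qed.

Lemma has_deriv_exp f n x v a : has_deriv f x v a ->
  has_deriv (fun z => f z ^+ n) x v (n%:R * f x ^+ n.-1 * a).
Proof.
move=> df; have := is_deriveX n df.
by rewrite (_ : f ^+ n = (fun z => f z ^+ n)) // exprfctE.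
Qed.

Lemma has_deriv_inv f x v a : f x != 0 -> has_deriv f x v a ->
  has_deriv (fun z => (f z)^-1) x v (- a / f x ^+ 2).
Proof.
move=> fx [df <-]; split; first exact: derivableV.
by rewrite deriveV // /GRing.scale /= mulNr mulrC mulNr.
Qed.

End DerivativeRules.

(** Reduces a goal [has_deriv f x v _], with the derivative left open, to
    derivatives of atoms, solved by [atom], and to the nonvanishing of
    denominators. *)
Tactic Notation "differentiate" "with" tactic3(atom) := repeat first
  [ apply: has_deriv_const | atom
  | apply: has_deriv_opp | apply: has_deriv_exp
  | apply: has_deriv_inv | apply: has_deriv_mul | apply: has_deriv_add ].

Section LinearComposition.
Variables (R : realType) (V W : normedModType R) (L : {linear V -> W}).
Implicit Types (f : W -> R) (p v : V) (a : R).

Let quotient_comp_linear f p v :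
  (fun h : R => h^-1 *: ((f \o shift (L p)) (h *: L v) - f (L p))) =
  (fun h => h^-1 *: ((f \o L \o shift p) (h *: v) - (f \o L) p)).
Proof. by apply/funext => h; rewrite /= (linearD L) (linearZ_LR L). Qed.

(** Both sides are limits of the same difference quotient.  The case
    [L v = 0] serves for derivatives along v and u. *)
Lemma derive_comp_linear f p v : 'D_v (f \o L) p = 'D_(L v) f (L p).
Proof. by rewrite /derive quotient_comp_linear. Qed.

Lemma is_derive_comp_linear f p v a :
  is_derive (L p) (L v) f a -> is_derive p v (f \o L) a.
Proof.
move=> [df da]; split; last by rewrite derive_comp_linear.
by move: df; rewrite /derivable quotient_comp_linear.
Qed.

End LinearComposition.

(** * Functions of class C^k *)

Section Smoothness.
Variables (R : realType) (n : nat) (U : set 'rV[R]_n.+1).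
Hypothesis openU : open U.
Implicit Types f g : 'rV[R]_n.+1 -> R.

Lemma near_eq_on f g p : (forall q, U q -> f q = g q) -> U p ->
  \near p, f p = g p.
Proof.
move=> fg Up; have : nbhs p U by apply: open_nbhs_nbhs.
by apply: filterS.
Qed.

Lemma partial_eq_on f g i p : (forall q, U q -> f q = g q) -> U p ->
  partial i f p = partial i g p.
Proof. by move=> fg Up; apply: near_eq_derive; exact: near_eq_on. Qed.

Lemma continuous_eq_on f g p : (forall q, U q -> f q = g q) -> U p ->
  {for p, continuous f} -> {for p, continuous g}.
Proof.
move=> fg Up cf; rewrite /prop_for /continuous_at -(fg p Up).
apply: cvg_trans cf; exact: (near_eq_cvg (near_eq_on fg Up)).
Qed.

Lemma Ck_on_eq k f g : (forall q, U q -> f q = g q) ->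
  Ck_on k U f -> Ck_on k U g.
Proof.
elim: k f g => [|k IH] f g fg /= [cf df].
  by split=> // p Up; apply: continuous_eq_on (cf p Up).
split=> [p Up|i]; first by apply: continuous_eq_on (cf p Up).
have [dfi Ci] := df i; split.
  by move=> p Up; apply: near_eq_derivable (dfi p Up); exact: near_eq_on.
by apply: IH Ci => q Uq; exact: partial_eq_on.
Qed.

Lemma Ck_on_S k f : Ck_on k.+1 U f -> Ck_on k U f.
Proof.
elim: k f => [|k IH] f [cf df]; first by split.
by split=> // i; have [? ?] := df i; split=> //; apply: IH.
Qed.

Lemma Ck_on_is_derive k f i p : Ck_on k.+1 U f -> U p ->
  is_derive p (delta_mx 0 i) f (partial i f p).
Proof. by move=> [_ /(_ i)[df _]] Up; split=> //; exact: df. Qed.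

(** [Ck_on] speaks of the total functions [partial i f]; off [U] they are
    arbitrary, so explicit derivatives can replace them on [U] only. *)
Lemma Ck_on_step k f (df : 'I_n.+1 -> 'rV[R]_n.+1 -> R) :
  (forall p, U p -> {for p, continuous f}) ->
  (forall i p, U p -> is_derive p (delta_mx 0 i) f (df i p)) ->
  (forall i, Ck_on k U (df i)) -> Ck_on k.+1 U f.
Proof.
move=> cf Df Cdf; split=> // i; split=> [p Up|]; first by have [] := Df i p Up.
by apply: Ck_on_eq (Cdf i) => q Uq; have [] := Df i q Uq.
Qed.

Lemma Ck_on_continuous k f p : Ck_on k U f -> U p -> {for p, continuous f}.
Proof. by case: k => [|k] [cf _]; exact: cf. Qed.

Lemma Ck_on_partial k f i : Ck_on k.+1 U f -> Ck_on k U (partial i f).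
Proof. by move=> [_ /(_ i)[]]. Qed.

Lemma Ck_on_const k c : Ck_on k U (fun=> c).
Proof.
elim: k c => [|k IH] c; first by split=> // p _; exact: cst_continuous.
apply: (@Ck_on_step k _ (fun _ _ => 0)) => [p _|i]; last exact: IH.
exact: cst_continuous.
Qed.

Lemma Ck_on_add k f g : Ck_on k U f -> Ck_on k U g ->
  Ck_on k U (fun p => f p + g p).
Proof.
elim: k f g => [|k IH] f g Cf Cg.
  by split=> // p Up; apply: continuousD;
    [exact: Ck_on_continuous Cf Up|exact: Ck_on_continuous Cg Up].
apply: (@Ck_on_step k _ (fun i p => partial i f p + partial i g p))
  => [p Up|i p Up|i].
- by apply: continuousD;
    [exact: Ck_on_continuous Cf Up|exact: Ck_on_continuous Cg Up].
- exact: (has_deriv_add (Ck_on_is_derive i Cf Up) (Ck_on_is_derive i Cg Up)).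
- by apply: IH; exact: Ck_on_partial.
Qed.

Lemma Ck_on_mul k f g : Ck_on k U f -> Ck_on k U g ->
  Ck_on k U (fun p => f p * g p).
Proof.
elim: k f g => [|k IH] f g Cf Cg.
  by split=> // p Up; apply: continuousM;
    [exact: Ck_on_continuous Cf Up|exact: Ck_on_continuous Cg Up].
apply: (@Ck_on_step k _ (fun i p => partial i f p * g p + f p * partial i g p))
  => [p Up|i p Up|i].
- by apply: continuousM;
    [exact: Ck_on_continuous Cf Up|exact: Ck_on_continuous Cg Up].
- exact: (has_deriv_mul (Ck_on_is_derive i Cf Up) (Ck_on_is_derive i Cg Up)).
- apply: Ck_on_add; apply: IH.
  + exact: Ck_on_partial.
  + exact: Ck_on_S.
  + exact: Ck_on_S.
  + exact: Ck_on_partial.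
Qed.

Lemma Ck_on_opp k f : Ck_on k U f -> Ck_on k U (fun p => - f p).
Proof.
move=> Cf; apply: (@Ck_on_eq _ (fun p => -1 * f p)).
  by move=> q _; rewrite mulN1r.
by apply: Ck_on_mul => //; exact: Ck_on_const.
Qed.

Lemma Ck_on_inv k f : (forall p, U p -> f p != 0) -> Ck_on k U f ->
  Ck_on k U (fun p => (f p)^-1).
Proof.
move=> f0; elim: k => [|k IH] Cf.
  split=> // p Up; apply: continuousV; first exact: f0.
  exact: Ck_on_continuous Cf Up.
(* The derivative is written with products of the inverse itself, to which the
   induction hypothesis applies. *)
apply: (@Ck_on_step k _ (fun i p => - partial i f p * ((f p)^-1 * (f p)^-1)))
  => [p Up|i p Up|i].
- by apply: continuousV; [exact: f0|exact: Ck_on_continuous Cf Up].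
- have := has_deriv_inv (f0 p Up) (Ck_on_is_derive i Cf Up).
  by rewrite expr2 invfM.
- have Ck := Ck_on_S Cf.
  apply: Ck_on_mul; last by apply: Ck_on_mul; exact: IH.
  by apply: Ck_on_opp; exact: Ck_on_partial.
Qed.

Lemma Ck_on_exp k f m : Ck_on k U f -> Ck_on k U (fun p => f p ^+ m).
Proof.
move=> Cf; elim: m => [|m IH]; first exact: Ck_on_const.
apply: (@Ck_on_eq _ (fun p => f p * f p ^+ m)) => [p _|].
  by rewrite exprS.
exact: Ck_on_mul.
Qed.

End Smoothness.

(** * The projection to the half plane *)

Section Coordinates.
Variable R : realType.

Definition coordinate n (i : 'I_n) (q : 'rV[R]_n) : R := q 0 i.

Fact coordinate_linear n (i : 'I_n) : scalar (@coordinate n i).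
Proof. by move=> a u v; rewrite /coordinate !mxE. Qed.

HB.instance Definition _ n (i : 'I_n) :=
  GRing.isLinear.Build R 'rV[R]_n R _ (@coordinate n i) (coordinate_linear i).

Lemma coordinate_delta n (i j : 'I_n) :
  coordinate i (delta_mx 0 j) = (i == j)%:R.
Proof. by rewrite /coordinate mxE eqxx. Qed.

Lemma is_derive_coordinate n (i j : 'I_n.+1) p :
  is_derive p (delta_mx 0 j) (coordinate i) (i == j)%:R.
Proof.
have := @is_derive_comp_linear R 'rV[R]_n.+1 R (coordinate i) id p
  (delta_mx 0 j) _.
apply; rewrite /= coordinate_delta; exact: is_derive_id.
Qed.

Lemma has_deriv_coordinate n (i j : 'I_n.+1) (p : 'rV[R]_n.+1) :
  has_deriv (fun z : 'rV[R]_n.+1 => z 0 i) p (delta_mx 0 j) (i == j)%:R.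
Proof. exact: is_derive_coordinate. Qed.

Lemma has_deriv_comp_coordinate n (f : R -> R) (i j : 'I_n.+1)
    (p : 'rV[R]_n.+1) (a : R) :
  has_deriv f (p 0 i) 1 a ->
  has_deriv (fun z : 'rV[R]_n.+1 => f (z 0 i)) p (delta_mx 0 j)
    ((i == j)%:R * a).
Proof.
move=> df.
have := @is_derive_comp_linear R 'rV[R]_n.+1 R (coordinate i) f p
  (delta_mx 0 j).
apply; rewrite /= coordinate_delta; case: (i == j) => /=.
  by rewrite mul1r.
by rewrite mul0r; exact: is_derive0.
Qed.

Lemma Ck_on_coordinate n k (U : set 'rV[R]_n.+1) i : open U ->
  Ck_on k U (coordinate i).
Proof.
move=> oU; case: k => [|k].
  by split=> // p _; exact: (@coord_continuous R 1 n.+1 0 i).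
apply: (Ck_on_step oU (df := fun j _ => (i == j)%:R)) => [p _|j p _|j].
- exact: coord_continuous.
- exact: is_derive_coordinate.
- exact: Ck_on_const.
Qed.

Fact half_plane_part_linear : linear (@half_plane_part R).
Proof. by move=> a u v; apply/rowP => i; rewrite !mxE. Qed.

HB.instance Definition _ :=
  GRing.isLinear.Build R 'rV[R]_4 'rV[R]_2 _ (@half_plane_part R)
    half_plane_part_linear.

Lemma half_plane_part_continuous : continuous (@half_plane_part R).
Proof.
move=> p A [B Bp BA].
exists (fun i j => if (j < 2)%N then setT else B i (inord (j - 2))).
  move=> i j; case: (ltnP j 2) => j2; first exact: filterT.
  have := Bp i (inord (j - 2)); rewrite mxE (ord1 i).
  case: j => [[|[|[|[|j]]]] hj] //= in j2 *; rewrite inordK //;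
    by rewrite (_ : inord _ = Ordinal hj) //; apply: val_inj; rewrite /= inordK.
move=> q Bq; apply: BA => i j; have := Bq i (inord (j + 2)).
have j4 : (j + 2 < 4)%N by rewrite -[4%N]/(2 + 2)%N ltn_add2r.
by rewrite inordK // ltnNge leq_addl addnK inord_val mxE (ord1 i).
Qed.

Lemma open_half_plane : open (@half_plane R).
Proof.
apply: (@open_comp _ _ (coordinate (inord 1)) [set y : R | 0 < y]).
  by move=> q _; exact: coord_continuous.
exact: open_gt.
Qed.

Lemma open_spacetime : open (@spacetime R).
Proof.
apply: (@open_comp _ _ (@half_plane_part R) (@half_plane R)).
  by move=> q _; exact: half_plane_part_continuous.
exact: open_half_plane.
Qed.

Lemma half_plane_part_delta (i : 'I_4) :
  half_plane_part (delta_mx 0 i : 'rV[R]_4) =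
  match val i with
  | 2%N => delta_mx 0 (inord 0) | 3%N => delta_mx 0 (inord 1) | _ => 0
  end.
Proof.
apply/rowP => j; rewrite !mxE eqxx /= -val_eqE.
by case: i => [[|[|[|[|i]]]] hi] //=; rewrite !mxE ?eqxx -?val_eqE /=;
  case: j => [[|[|j]] hj] //=; rewrite ?inordK.
Qed.

(** The derivative along coordinate [i] of R^4 of a function that depends on the
    half plane part alone; x and y are the coordinates 2 and 3 of R^4. *)
Definition lifted_partial (i : 'I_4) (G : 'rV[R]_2 -> R) (q : 'rV[R]_2) : R :=
  match val i with
  | 2%N => partial (inord 0) G q | 3%N => partial (inord 1) G q | _ => 0
  end.

Lemma partial_pullback i G p :
  partial i (G \o @half_plane_part R) p =
  lifted_partial i G (half_plane_part p).
Proof.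
rewrite /partial derive_comp_linear /= half_plane_part_delta /lifted_partial.
by case: i => [[|[|[|[|i]]]] hi] //=; rewrite derive0.
Qed.

Lemma is_derive_pullback k G i p : Ck_on k.+1 (@half_plane R) G ->
  spacetime p ->
  is_derive p (delta_mx 0 i) (G \o @half_plane_part R)
    (lifted_partial i G (half_plane_part p)).
Proof.
move=> CG Hp; apply: is_derive_comp_linear; rewrite /= half_plane_part_delta.
rewrite /lifted_partial.
by case: i => [[|[|[|[|i]]]] hi] //=;
  by [exact: is_derive0 | exact: (Ck_on_is_derive _ CG Hp)].
Qed.

Lemma Ck_on_pullback k G : Ck_on k (@half_plane R) G ->
  Ck_on k (@spacetime R) (G \o @half_plane_part R).
Proof.
elim: k G => [|k IH] G CG.
  split=> // p Hp; apply: continuous_comp.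
    exact: half_plane_part_continuous.
  exact: Ck_on_continuous CG Hp.
apply: (Ck_on_step open_spacetime
  (df := fun i => lifted_partial i G \o @half_plane_part R))
  => [p Hp|i p Hp|i].
- apply: continuous_comp; first exact: half_plane_part_continuous.
  exact: Ck_on_continuous CG Hp.
- exact: is_derive_pullback CG Hp.
- apply: IH; rewrite /lifted_partial.
  by case: i => [[|[|[|[|i]]]] hi] //=;
    by [exact: (Ck_on_const open_half_plane) | exact: Ck_on_partial].
Qed.

End Coordinates.

(** * Sums over four indices and inverse matrices *)

Local Notation o0 := (Ordinal (isT : (0 < 4)%N)).
Local Notation o1 := (Ordinal (isT : (1 < 4)%N)).
Local Notation o2 := (Ordinal (isT : (2 < 4)%N)).
Local Notation o3 := (Ordinal (isT : (3 < 4)%N)).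

Lemma sum_ord4 (V : nmodType) (f : 'I_4 -> V) :
  \sum_i f i = f o0 + f o1 + f o2 + f o3.
Proof.
rewrite !big_ord_recl big_ord0 addr0 !addrA.
by congr (_ + _ + _ + _); congr f; apply: val_inj.
Qed.

Lemma ord4_ind (P : 'I_4 -> Prop) :
  P o0 -> P o1 -> P o2 -> P o3 -> forall i, P i.
Proof.
move=> P0 P1 P2 P3 [[|[|[|[|i]]]] hi] //;
  [move: P0|move: P1|move: P2|move: P3]; by congr P; apply: val_inj.
Qed.

Lemma invmx_eq (R : comUnitRingType) n (A B : 'M[R]_n) :
  A *m B = 1%:M -> invmx A = B.
Proof.
move=> AB; have [uA _] := mulmx1_unit AB.
by rewrite -[LHS]mulmx1 -AB mulKmx.
Qed.

(** * Christoffel symbols *)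

Section Christoffel.
Variable R : realType.
Implicit Types q : 'rV[R]_2.

Variables (lambda : R) (F : 'rV[R]_2 -> R).
Hypotheses (lambda0 : lambda != 0) (smoothF : smooth_on (@half_plane R) F).

Local Notation y q := (q 0 (inord 1)).
Local Notation Fx := (partial (inord 0) F).
Local Notation Fy := (partial (inord 1) F).

(** The components of tensors are tabulated as functions on the half plane,
    with the indices 0, 1, 2, 3 standing for v, u, x, y, so that they are
    differentiated along x and y only. *)
Definition metric_coef (i j : nat) q : R :=
  match i, j with
  | 0%N, 0%N => F q
  | 0%N, 1%N | 1%N, 0%N => (2 * y q ^+ 2)^-1
  | 2%N, 2%N | 3%N, 3%N => (lambda ^+ 2 * y q ^+ 2)^-1
  | _, _ => 0
  end.

Definition inverse_metric_coef (i j : nat) q : R :=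
  match i, j with
  | 1%N, 1%N => - (4 * y q ^+ 4 * F q)
  | 0%N, 1%N | 1%N, 0%N => 2 * y q ^+ 2
  | 2%N, 2%N | 3%N, 3%N => lambda ^+ 2 * y q ^+ 2
  | _, _ => 0
  end.

Definition christoffel_coef (k i j : nat) q : R :=
  match k, i, j with
  | 0%N, 0%N, 3%N | 0%N, 3%N, 0%N => - (y q)^-1
  | 1%N, 0%N, 2%N | 1%N, 2%N, 0%N => y q ^+ 2 * Fx q
  | 1%N, 0%N, 3%N | 1%N, 3%N, 0%N => y q ^+ 2 * Fy q + 2 * y q * F q
  | 1%N, 1%N, 3%N | 1%N, 3%N, 1%N => - (y q)^-1
  | 2%N, 0%N, 0%N => - (lambda ^+ 2 / 2 * y q ^+ 2 * Fx q)
  | 2%N, 2%N, 3%N | 2%N, 3%N, 2%N => - (y q)^-1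
  | 3%N, 0%N, 0%N => - (lambda ^+ 2 / 2 * y q ^+ 2 * Fy q)
  | 3%N, 0%N, 1%N | 3%N, 1%N, 0%N => lambda ^+ 2 / 2 * (y q)^-1
  | 3%N, 2%N, 2%N => (y q)^-1
  | 3%N, 3%N, 3%N => - (y q)^-1
  | _, _, _ => 0
  end.

Lemma metricE p i j :
  metric lambda F p i j = metric_coef i j (half_plane_part p).
Proof. by rewrite mxE. Qed.

Lemma y_neq0 q : half_plane q -> y q != 0.
Proof. by move=> Hq; rewrite gt_eqF. Qed.

Lemma invmx_metric p : spacetime p ->
  invmx (metric lambda F p) =
  \matrix_(i, j) inverse_metric_coef i j (half_plane_part p).
Proof.
move=> /y_neq0; set q := half_plane_part p => y0.
apply: invmx_eq; apply/matrixP => i j.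
rewrite mxE sum_ord4 !metricE -/q !mxE -val_eqE.
case: i => [[|[|[|[|i]]]] hi] //; case: j => [[|[|[|[|j]]]] hj] //=;
  by field; rewrite ?lambda0 ?y0.
Qed.

Lemma has_deriv_F (j : 'I_2) q : half_plane q ->
  has_deriv F q (delta_mx 0 j) (partial j F q).
Proof. exact: (Ck_on_is_derive j (smoothF 1)). Qed.

Lemma has_deriv_partialF (i j : 'I_2) q : half_plane q ->
  has_deriv (partial i F) q (delta_mx 0 j) (partial j (partial i F) q).
Proof. exact: (Ck_on_is_derive j (Ck_on_partial i (smoothF 2))). Qed.

(** In this and the next table of derivatives, [dy] stands for the derivative
    of y along coordinate [l]: 0 if this is x and 1 if it is y. *)
Definition metric_coef_partial (l : 'I_2) (dy : R) (i j : nat) q : R :=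
  match i, j with
  | 0%N, 0%N => partial l F q
  | 0%N, 1%N | 1%N, 0%N => - dy / y q ^+ 3
  | 2%N, 2%N | 3%N, 3%N => - (2 * dy) / (lambda ^+ 2 * y q ^+ 3)
  | _, _ => 0
  end.

Lemma partial_metric_coef l i j q : half_plane q ->
  partial l (metric_coef i j) q = metric_coef_partial l (inord 1 == l)%:R i j q.
Proof.
move=> Hq; have y0 := y_neq0 Hq.
rewrite /metric_coef /metric_coef_partial.
move: i j => [|[|[|[|i]]]] [|[|[|[|j]]]]; apply: has_deriv_val;
  (apply: has_deriv_eq;
    [by differentiate with
      (first [apply: has_deriv_coordinate | exact: has_deriv_F]);
      rewrite !mulf_neq0 ?expf_neq0 ?pnatr_eq0
    |rewrite //=; move: ((inord 1 == l)%:R : R) => dy;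
     by field; rewrite ?lambda0 ?y0]).
Qed.

Definition christoffel_coef_partial (l : 'I_2) (dy : R) (k i j : nat) q : R :=
  match k, i, j with
  | 0%N, 0%N, 3%N | 0%N, 3%N, 0%N => dy / y q ^+ 2
  | 1%N, 0%N, 2%N | 1%N, 2%N, 0%N =>
      2 * y q * dy * Fx q + y q ^+ 2 * partial l Fx q
  | 1%N, 0%N, 3%N | 1%N, 3%N, 0%N =>
      2 * y q * dy * Fy q + y q ^+ 2 * partial l Fy q
      + 2 * dy * F q + 2 * y q * partial l F q
  | 1%N, 1%N, 3%N | 1%N, 3%N, 1%N => dy / y q ^+ 2
  | 2%N, 0%N, 0%N => - (lambda ^+ 2 / 2 *
      (2 * y q * dy * Fx q + y q ^+ 2 * partial l Fx q))
  | 2%N, 2%N, 3%N | 2%N, 3%N, 2%N => dy / y q ^+ 2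
  | 3%N, 0%N, 0%N => - (lambda ^+ 2 / 2 *
      (2 * y q * dy * Fy q + y q ^+ 2 * partial l Fy q))
  | 3%N, 0%N, 1%N | 3%N, 1%N, 0%N => - (lambda ^+ 2 / 2 * dy / y q ^+ 2)
  | 3%N, 2%N, 2%N => - (dy / y q ^+ 2)
  | 3%N, 3%N, 3%N => dy / y q ^+ 2
  | _, _, _ => 0
  end.

Lemma partial_christoffel_coef l k i j q : half_plane q ->
  partial l (christoffel_coef k i j) q =
  christoffel_coef_partial l (inord 1 == l)%:R k i j q.
Proof.
move=> Hq; have y0 := y_neq0 Hq.
rewrite /christoffel_coef /christoffel_coef_partial.
move: k i j => [|[|[|[|k]]]] [|[|[|[|i]]]] [|[|[|[|j]]]]; apply: has_deriv_val;
  (apply: has_deriv_eq;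
    [by differentiate with (first
      [ apply: has_deriv_coordinate | exact: has_deriv_F
      | exact: has_deriv_partialF ])
    |rewrite //=; move: ((inord 1 == l)%:R : R) => dy;
     by field; rewrite ?lambda0 ?y0]).
Qed.

Lemma christoffelE k i j p : spacetime p ->
  christoffel (metric lambda F) k i j p =
  christoffel_coef k i j (half_plane_part p).
Proof.
move=> Hp; have y0 := y_neq0 Hp.
have dg l a b : partial l (fun z => metric lambda F z a b) p =
    lifted_partial l (metric_coef a b) (half_plane_part p).
  rewrite -partial_pullback; congr partial.
  by apply/funext => z; rewrite metricE.
rewrite /christoffel sum_ord4 invmx_metric // !dg !mxE /lifted_partial.
rewrite !partial_metric_coef // /metric_coef_partial eqxx -!val_eqE /=.
rewrite !inordK //.
move: (half_plane_part p) y0 => q y0.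
case: k => [[|[|[|[|k]]]] hk] //; case: i => [[|[|[|[|i]]]] hi] //;
  case: j => [[|[|[|[|j]]]] hj] //=; by field; rewrite ?lambda0 ?y0.
Qed.

End Christoffel.

(** * The Einstein equation *)

Section Ricci.
Variable R : realType.
Variables (lambda : R) (F : 'rV[R]_2 -> R).
Hypotheses (lambda0 : lambda != 0) (smoothF : smooth_on (@half_plane R) F).

Local Notation y q := (q 0 (inord 1)).
Local Notation x q := (q 0 (inord 0)).

(** The condition on F expressed by the vv component of the Einstein
    equation. *)
Definition einstein_equation : Prop := forall q : 'rV[R]_2, half_plane q ->
  y q ^+ 2 * (partial (inord 0) (partial (inord 0) F) q
              + partial (inord 1) (partial (inord 1) F) q)
  + 2 * y q * partial (inord 1) F q = 2 * F q.

Lemma partial_christoffel l k i j p : spacetime p ->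
  partial l (christoffel (metric lambda F) k i j) p =
  lifted_partial l (christoffel_coef lambda F k i j) (half_plane_part p).
Proof.
move=> Hp; rewrite -partial_pullback.
apply: (partial_eq_on (@open_spacetime R)) => // z Hz.
by rewrite christoffelE.
Qed.

Lemma ricciE p j k : spacetime p ->
  let q := half_plane_part p in
  ricci (metric lambda F) p j k =
  \sum_(i < 4) (lifted_partial i (christoffel_coef lambda F i j k) q
    - lifted_partial j (christoffel_coef lambda F i i k) q
    + \sum_(m < 4)
        (christoffel_coef lambda F i i m q * christoffel_coef lambda F m j k q
         - christoffel_coef lambda F i j m q
           * christoffel_coef lambda F m i k q)).
Proof.
move=> Hp q; rewrite mxE; apply: eq_bigr => i _.
rewrite /riemann !partial_christoffel //; congr (_ + _).
by apply: eq_bigr => m _; rewrite !christoffelE.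
Qed.

Lemma lifted_partial_christoffel l k i j q : half_plane q ->
  lifted_partial l (christoffel_coef lambda F k i j) q =
  match val l with
  | 2%N => christoffel_coef_partial lambda F (inord 0) 0 k i j q
  | 3%N => christoffel_coef_partial lambda F (inord 1) 1 k i j q
  | _ => 0
  end.
Proof.
move=> Hq; rewrite /lifted_partial !partial_christoffel_coef // eqxx.
by rewrite -val_eqE /= !inordK.
Qed.

Lemma einstein_metric : einstein_equation ->
  einstein_on (@spacetime R) (metric lambda F) (- 3 * lambda ^+ 2).
Proof.
move=> eqF p Hp; apply/matrixP => j k.
rewrite ricciE // mxE metricE.
have Hq : half_plane (half_plane_part p) := Hp.
have y0 := y_neq0 Hq; have := eqF _ Hq.
move: (half_plane_part p) y0 Hq => q y0 Hq.
case: j => [[|[|[|[|j]]]] hj] //; case: k => [[|[|[|[|k]]]] hk] //=;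
  rewrite !sum_ord4 !lifted_partial_christoffel //=;
  move: (partial (inord 0) (partial (inord 0) F) q) => fxx;
  move: (partial (inord 1) (partial (inord 1) F) q) => fyy;
  move: (partial (inord 0) F q) => fx;
  move: (partial (inord 1) F q) => fy;
  move: (F q) (y q) y0 => f t t0 eqf;
  try by field; rewrite ?lambda0 ?t0.
(* Only the vv component is left; it holds by the equation for F. *)
have -> : fxx = (2 * f - 2 * t * fy) / t ^+ 2 - fyy by rewrite -eqf; field.
by field.
Qed.

Lemma partial_separated (G : 'rV[R]_2 -> R) (A A1 B B1 : R -> R) :
  (forall x, has_deriv A x 1 (A1 x)) ->
  (forall t, 0 < t -> has_deriv B t 1 (B1 t)) ->
  (forall q, half_plane q -> G q = A (x q) * B (y q)) ->
  forall q, half_plane q ->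
    partial (inord 0) G q = A1 (x q) * B (y q) /\
    partial (inord 1) G q = A (x q) * B1 (y q).
Proof.
move=> dA dB GE q Hq.
have dG j : partial j G q = (inord 0 == j)%:R * A1 (x q) * B (y q)
                            + A (x q) * ((inord 1 == j)%:R * B1 (y q)).
  rewrite (partial_eq_on (@open_half_plane R) _ GE Hq).
  apply: has_deriv_val; apply: has_deriv_mul; apply: has_deriv_comp_coordinate.
    exact: dA.
  exact: dB.
by rewrite !dG !eqxx -!val_eqE /= !inordK // !mul0r !mul1r mulr0 addr0 add0r.
Qed.

(** For F = X(x) Y(y) with X'' = k X, the factor X divides the equation and
    leaves y^2 Y'' + 2 y Y' = (2 - k y^2) Y. *)
Lemma einstein_equation_separated (k : R) (X X1 Y Y1 : R -> R) :
  (forall x, has_deriv X x 1 (X1 x)) ->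
  (forall x, has_deriv X1 x 1 (k * X x)) ->
  (forall t, 0 < t -> has_deriv Y t 1 (Y1 t)) ->
  (forall t, 0 < t ->
     has_deriv Y1 t 1 ((2 / t ^+ 2 - k) * Y t - 2 / t * Y1 t)) ->
  (forall q, half_plane q -> F q = X (x q) * Y (y q)) ->
  einstein_equation.
Proof.
move=> dX dX1 dY dY1 FE q Hq; have y0 := y_neq0 Hq.
have Fx z (Hz : half_plane z) := proj1 (partial_separated dX dY FE Hz).
have Fy z (Hz : half_plane z) := proj2 (partial_separated dX dY FE Hz).
have [Fxx _] := partial_separated dX1 dY Fx Hq.
have [_ Fyy] := partial_separated dX dY1 Fy Hq.
by rewrite Fxx Fyy Fy // FE //; field.
Qed.

End Ricci.

Section Profiles.
Variable R : realType.
Implicit Types (f : R -> R) (x t a : R).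

Lemma has_deriv_expR f x a : has_deriv f x 1 a ->
  has_deriv (fun z => expR (f z)) x 1 (expR (f x) * a).
Proof. by move=> df; apply: is_derive1_comp. Qed.

Lemma has_deriv_sin f x a : has_deriv f x 1 a ->
  has_deriv (fun z => sin (f z)) x 1 (cos (f x) * a).
Proof. by move=> df; apply: is_derive1_comp. Qed.

Lemma has_deriv_cos f x a : has_deriv f x 1 a ->
  has_deriv (fun z => cos (f z)) x 1 (- sin (f x) * a).
Proof. by move=> df; apply: is_derive1_comp. Qed.

Lemma has_deriv_id x : has_deriv (fun z : R => z) x 1 1.
Proof. exact: is_derive_id. Qed.

Tactic Notation "differentiate" := differentiate with (first
  [ apply: has_deriv_id | apply: has_deriv_expR | apply: has_deriv_sin
  | apply: has_deriv_cos ]).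

Lemma einstein_equation_rational (F : 'rV[R]_2 -> R) a1 a2 a3 a4 :
  (forall q, half_plane q -> F q = rational_form a1 a2 a3 a4 q) ->
  einstein_equation F.
Proof.
apply: (@einstein_equation_separated _ _ 0 (fun x => a1 + a2 * x) (fun=> a2)
  (fun t => a3 * t + a4 / t ^+ 2) (fun t => a3 - 2 * a4 / t ^+ 3))
  => [x|x|t t0|t t0].
- by apply: has_deriv_eq; [differentiate|rewrite /=; ring].
- by apply: has_deriv_eq; [differentiate|rewrite /=; ring].
- have {}t0 : t != 0 by rewrite gt_eqF.
  by apply: has_deriv_eq; [differentiate; rewrite expf_neq0|rewrite /=; field].
- have {}t0 : t != 0 by rewrite gt_eqF.
  by apply: has_deriv_eq; [differentiate; rewrite expf_neq0|rewrite /=; field].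
Qed.

Lemma einstein_equation_bessel (F : 'rV[R]_2 -> R) a1 a2 a3 a4 c : c != 0 ->
  (forall q, half_plane q -> F q = bessel_form a1 a2 a3 a4 c q) ->
  einstein_equation F.
Proof.
move=> c0.
(* The derivatives of the spherical Bessel functions. *)
pose BJ1 (z : R) := 2 * cos z / z ^+ 2 - 2 * sin z / z ^+ 3 + sin z / z.
pose BY1 (z : R) := 2 * sin z / z ^+ 2 + 2 * cos z / z ^+ 3 - cos z / z.
apply: (@einstein_equation_separated _ _ (c ^+ 2)
  (fun x => a1 * expR (c * x) + a2 * expR (- (c * x)))
  (fun x => c * (a1 * expR (c * x) - a2 * expR (- (c * x))))
  (fun t => a3 * BY (c * t) + a4 * BJ (c * t))
  (fun t => c * (a3 * BY1 (c * t) + a4 * BJ1 (c * t)))) => [x|x|t t0|t t0].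
- by apply: has_deriv_eq; [differentiate|rewrite /=; ring].
- by apply: has_deriv_eq; [differentiate|rewrite /=; ring].
- have {}t0 : t != 0 by rewrite gt_eqF.
  rewrite /BY /BJ /BY1 /BJ1.
  apply: has_deriv_eq; first by differentiate; rewrite ?expf_neq0 ?mulf_neq0.
  rewrite /=; move: (sin (c * t)) (cos (c * t)) => s k.
  by field; rewrite ?c0 ?t0.
- have {}t0 : t != 0 by rewrite gt_eqF.
  rewrite /BY /BJ /BY1 /BJ1.
  apply: has_deriv_eq; first by differentiate; rewrite ?expf_neq0 ?mulf_neq0.
  rewrite /=; move: (sin (c * t)) (cos (c * t)) => s k.
  by field; rewrite ?c0 ?t0.
Qed.

End Profiles.

(** * The Clifford module *)

Section CliffordModule.
Variable R : realType.

(** Real Dirac matrices, the Kronecker products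
      gamma_0 = (i s2) x 1,  gamma_1 = s1 x 1,
      gamma_2 = s3 x s1,     gamma_3 = s3 x s3
    of Pauli matrices s1, s2, s3.  They are signed permutation matrices, and
    gamma_0 gamma_1 = s3 x 1 and gamma_3 are diagonal. *)
Definition majorana_coef (a r s : nat) : R :=
  match a, r, s with
  | 0%N, 0%N, 2%N | 0%N, 1%N, 3%N => 1
  | 0%N, 2%N, 0%N | 0%N, 3%N, 1%N => -1
  | 1%N, 0%N, 2%N | 1%N, 1%N, 3%N | 1%N, 2%N, 0%N | 1%N, 3%N, 1%N => 1
  | 2%N, 0%N, 1%N | 2%N, 1%N, 0%N => 1
  | 2%N, 2%N, 3%N | 2%N, 3%N, 2%N => -1
  | 3%N, 0%N, 0%N | 3%N, 3%N, 3%N => 1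
  | 3%N, 1%N, 1%N | 3%N, 2%N, 2%N => -1
  | _, _, _ => 0
  end.

Definition majorana (a : 'I_4) : 'M[R]_4 := \matrix_(r, s) majorana_coef a r s.

Lemma etaE (a b : 'I_4) :
  Defs.eta R a b = (if val a is 0%N then -1 else 1) *+ (val a == val b).
Proof. by rewrite !mxE val_eqE; case: a => [[|a] ha]. Qed.

Lemma majorana_clifford a b :
  majorana a *m majorana b + majorana b *m majorana a = (2 * Defs.eta R a b)%:M.
Proof.
apply/matrixP => r s; rewrite etaE !mxE !sum_ord4 !mxE -val_eqE.
case: a => [[|[|[|[|a]]]] ha] //; case: b => [[|[|[|[|b]]]] hb] //;
  case: r => [[|[|[|[|r]]]] hr] //; case: s => [[|[|[|[|s]]]] hs] //=; ring.
Qed.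

Section Submodule.
Variable V : 'M[R]_4.
Hypothesis stableV : forall a, stablemx V (majorana a)^T.

Lemma majorana_sub (w : 'rV[R]_4) a :
  (w <= V)%MS -> (w *m (majorana a)^T <= V)%MS.
Proof. by move=> wV; apply: submx_trans (stableV a); exact: submxMr. Qed.

(** The four coordinate lines are the joint eigenlines of gamma_0 gamma_1 and
    gamma_3, for the pairs of signs (s1, s3).  Hence
    (1 + s1 gamma_0 gamma_1) (1 + s3 gamma_3) / 4 is the projector onto such a
    line, and it preserves every submodule. *)
Lemma basis_sub_of_neq0 (w : 'rV[R]_4) k : (w <= V)%MS -> w 0 k != 0 ->
  ((delta_mx 0 k : 'rV[R]_4) <= V)%MS.
Proof.
move=> wV wk.
pose s1 : R := if (k < 2)%N then 1 else -1.
pose s3 : R := majorana_coef 3 k k.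
pose v := w *m (majorana o1)^T *m (majorana o0)^T.
have -> : (delta_mx 0 k : 'rV[R]_4) = (4 * w 0 k)^-1 *:
    (w + s1 *: v + s3 *: (w *m (majorana o3)^T)
     + (s1 * s3) *: (v *m (majorana o3)^T)).
  apply/rowP => j; rewrite /v !mxE -val_eqE /s1 /s3.
  do 2 (rewrite !sum_ord4 !mxE); rewrite !sum_ord4 !mxE.
  move: wk; elim/ord4_ind: k @s1 @s3; elim/ord4_ind: j => /= wk; by field.
have v3V : (v *m (majorana o3)^T <= V)%MS by do 3 apply: majorana_sub.
have vV : (v <= V)%MS by do 2 apply: majorana_sub.
have w3V : (w *m (majorana o3)^T <= V)%MS by apply: majorana_sub.
by rewrite scalemx_sub // !addmx_sub // scalemx_sub.
Qed.

Lemma basis_sub_majorana (k l : 'I_4) (c : R) (a : 'I_4) : c != 0 ->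
  (forall r : 'I_4, majorana_coef a r k = c * (r == l)%:R) ->
  ((delta_mx 0 k : 'rV[R]_4) <= V)%MS ->
  ((delta_mx 0 l : 'rV[R]_4) <= V)%MS.
Proof.
move=> c0 kl /(majorana_sub a).
rewrite (_ : _ *m _ = c *: (delta_mx 0 l : 'rV[R]_4)).
  by move=> /(scalemx_sub c^-1); rewrite scalerA mulVf // scale1r.
by apply/rowP => r; rewrite -rowE !mxE kl eqxx.
Qed.

Lemma all_basis_sub k : ((delta_mx 0 k : 'rV[R]_4) <= V)%MS ->
  forall l, ((delta_mx 0 l : 'rV[R]_4) <= V)%MS.
Proof.
pose sub (m : 'I_4) : bool := ((delta_mx 0 m : 'rV[R]_4) <= V)%MS.
have N1 : (-1 : R) != 0 by rewrite oppr_eq0 oner_eq0.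
have N0 : (1 : R) != 0 by rewrite oner_eq0.
(* The actions of gamma_2 and gamma_1 in turn move through the whole basis,
   in the order 0, 1, 3, 2, 0, up to sign. *)
have S01 : sub o0 -> sub o1.
  apply: (@basis_sub_majorana _ _ 1 o2 N0).
  by elim/ord4_ind; rewrite /= ?(mulr0, mulr1).
have S13 : sub o1 -> sub o3.
  apply: (@basis_sub_majorana _ _ 1 o1 N0).
  by elim/ord4_ind; rewrite /= ?(mulr0, mulr1).
have S32 : sub o3 -> sub o2.
  apply: (@basis_sub_majorana _ _ (-1) o2 N1).
  by elim/ord4_ind; rewrite /= ?(mulr0, mulr1).
have S20 : sub o2 -> sub o0.
  apply: (@basis_sub_majorana _ _ 1 o1 N0).
  by elim/ord4_ind; rewrite /= ?(mulr0, mulr1).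
rewrite -/(sub k) => + l; rewrite -/(sub l).
by elim/ord4_ind: k; elim/ord4_ind: l; auto.
Qed.

Lemma row_full_of_neq0 : V != 0 -> row_full V.
Proof.
case/matrix0Pn => i [k Vik].
have kV : ((delta_mx 0 k : 'rV[R]_4) <= V)%MS.
  by apply: (@basis_sub_of_neq0 (row i V)); [exact: row_sub|rewrite mxE].
rewrite -sub1mx; apply/row_subP => l; rewrite row1.
exact: all_basis_sub kV l.
Qed.

End Submodule.

Lemma majorana_irreducible : irreducible_clifford_module majorana.
Proof.
split; first exact: majorana_clifford.
move=> V stableV; have [->|V0] := eqVneq V 0; first by left.
by right; exact: row_full_of_neq0.
Qed.

End CliffordModule.

(** * The Killing spinor *)

Section KillingSpinor.
Variable R : realType.
Implicit Types q : 'rV[R]_2.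
Variables (lambda : R) (F : 'rV[R]_2 -> R).
Hypotheses (lambda0 : lambda != 0) (smoothF : smooth_on (@half_plane R) F).

Local Notation y q := (q 0 (inord 1)).
Local Notation Fx := (partial (inord 0) F).
Local Notation Fy := (partial (inord 1) F).

(** The coframe with e^1 + e^0 = dx^v / y^2 and e^1 - e^0 = y^2 F dx^v + dx^u,
    together with e^2 = dx / (lambda y) and e^3 = dy / (lambda y).  The factors
    y^(-2) and y^2 make the components of the Killing spinor constant. *)
Definition coframe_coef (a i : nat) q : R :=
  match a, i with
  | 0%N, 0%N => 2^-1 * ((y q ^+ 2)^-1 - y q ^+ 2 * F q)
  | 0%N, 1%N => - 2^-1
  | 1%N, 0%N => 2^-1 * ((y q ^+ 2)^-1 + y q ^+ 2 * F q)
  | 1%N, 1%N => 2^-1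
  | 2%N, 2%N | 3%N, 3%N => (lambda * y q)^-1
  | _, _ => 0
  end.

(** Column b holds the components of the b-th vector of the dual frame. *)
Definition frame_coef (j b : nat) q : R :=
  match j, b with
  | 0%N, 0%N | 0%N, 1%N => y q ^+ 2
  | 1%N, 0%N => - 1 - y q ^+ 4 * F q
  | 1%N, 1%N => 1 - y q ^+ 4 * F q
  | 2%N, 2%N | 3%N, 3%N => lambda * y q
  | _, _ => 0
  end.

Definition adapted_coframe p : 'M[R]_4 :=
  \matrix_(a, i) coframe_coef a i (half_plane_part p).

Lemma Ck_on_coframe_coef k a i : Ck_on k (@half_plane R) (coframe_coef a i).
Proof.
have oU := @open_half_plane R.
have Cc c := Ck_on_const oU k c.
have Cy n : Ck_on k (@half_plane R) (fun q => y q ^+ n).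
  by apply: Ck_on_exp => //; exact: (Ck_on_coordinate k (inord 1) oU).
have CiY : Ck_on k (@half_plane R) (fun q => (y q ^+ 2)^-1).
  apply: Ck_on_inv => // q Hq; rewrite expf_neq0 //; exact: y_neq0.
have CyF : Ck_on k (@half_plane R) (fun q => y q ^+ 2 * F q).
  by apply: Ck_on_mul => //; exact: smoothF.
have Ciy : Ck_on k (@half_plane R) (fun q => (lambda * y q)^-1).
  apply: Ck_on_inv => // [q Hq|]; first by rewrite mulf_neq0 // y_neq0.
  by apply: Ck_on_mul => //; exact: (Cy 1%N).
rewrite /coframe_coef.
move: a i => [|[|[|[|a]]]] [|[|[|[|i]]]] //.
  apply: (Ck_on_mul oU) => //; apply: Ck_on_add => //; exact: Ck_on_opp.
by apply: (Ck_on_mul oU) => //; apply: Ck_on_add.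
Qed.

Lemma adapted_coframe_orthonormal :
  orthonormal_coframe (@spacetime R) (metric lambda F) adapted_coframe.
Proof.
split=> [a i k|p Hp].
  apply: (@Ck_on_eq _ _ _ (@open_spacetime R) _
    (coframe_coef a i \o @half_plane_part R)).
    by move=> p _; rewrite mxE.
  by apply: Ck_on_pullback; exact: Ck_on_coframe_coef.
apply/matrixP => i j; rewrite metricE !mxE !sum_ord4 !mxE !sum_ord4 !mxE.
have := y_neq0 Hp; rewrite /coframe_coef /metric_coef.
move: (F _) (y _) => f t t0.
by elim/ord4_ind: i; elim/ord4_ind: j => /=; field; rewrite ?lambda0 ?t0.
Qed.

(** As before, [dy] is the derivative of y along coordinate [l]. *)
Definition coframe_coef_partial (l : 'I_2) (dy : R) (a i : nat) q : R :=
  match a, i with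
  | 0%N, 0%N =>
      - dy / y q ^+ 3 - y q * dy * F q - 2^-1 * y q ^+ 2 * partial l F q
  | 1%N, 0%N =>
      - dy / y q ^+ 3 + y q * dy * F q + 2^-1 * y q ^+ 2 * partial l F q
  | 2%N, 2%N | 3%N, 3%N => - dy / (lambda * y q ^+ 2)
  | _, _ => 0
  end.

Lemma partial_coframe_coef l a i q : half_plane q ->
  partial l (coframe_coef a i) q =
  coframe_coef_partial l (inord 1 == l)%:R a i q.
Proof.
move=> Hq; have y0 := y_neq0 Hq.
rewrite /coframe_coef /coframe_coef_partial.
move: a i => [|[|[|[|a]]]] [|[|[|[|i]]]]; apply: has_deriv_val;
  (apply: has_deriv_eq;
    [by differentiate with
      (first [apply: has_deriv_coordinate | exact: (has_deriv_F smoothF)]);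
      rewrite ?expf_neq0 ?mulf_neq0
    |rewrite //=; move: ((inord 1 == l)%:R : R) => dy;
     move: (partial l F q) (F q) => df f; by field; rewrite ?lambda0 ?y0]).
Qed.

Lemma partial_adapted_coframe i a j p : spacetime p ->
  let q := half_plane_part p in
  partial i (fun z => adapted_coframe z a j) p =
  match val i with
  | 2%N => coframe_coef_partial (inord 0) 0 a j q
  | 3%N => coframe_coef_partial (inord 1) 1 a j q
  | _ => 0
  end.
Proof.
move=> Hp q.
rewrite (_ : (fun z => _) = coframe_coef a j \o @half_plane_part R); last first.
  by apply/funext => z; rewrite mxE.
rewrite partial_pullback /lifted_partial !partial_coframe_coef // eqxx.
by rewrite -val_eqE /= !inordK.
Qed.

Lemma invmx_adapted_coframe p : spacetime p ->
  invmx (adapted_coframe p) =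
  \matrix_(j, b) frame_coef j b (half_plane_part p).
Proof.
move=> Hp; have y0 := y_neq0 Hp.
apply: invmx_eq; apply/matrixP => i j.
rewrite mxE sum_ord4 !mxE -val_eqE /coframe_coef /frame_coef.
move: (F _) (y _) y0 => f t t0.
by elim/ord4_ind: i; elim/ord4_ind: j => /=; field; rewrite ?lambda0 ?t0.
Qed.

(** omega^a_b(d_i).  Referred to e^+ = e^1 + e^0, e^- = e^1 - e^0, e^2, e^3,
    the nonzero connection forms are, up to the antisymmetry of omega,
      omega^+_+ = lambda e^3,  omega^2_3 = - lambda e^2,
      omega^+_3 = - lambda e^+,  omega^-_2 = lambda y^5 F_x e^+,
      omega^-_3 = - lambda e^- + lambda y^4 (2 F + y F_y) e^+.
    The terms with F and its derivatives are the null rotations fixing e^+. *)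
Definition connection_coef (i a b : nat) q : R :=
  match i, a, b with
  | 0%N, 0%N, 2%N | 0%N, 2%N, 0%N => - (lambda / 2 * y q ^+ 3 * Fx q)
  | 0%N, 1%N, 2%N => lambda / 2 * y q ^+ 3 * Fx q
  | 0%N, 2%N, 1%N => - (lambda / 2 * y q ^+ 3 * Fx q)
  | 0%N, 0%N, 3%N | 0%N, 3%N, 0%N =>
      - (lambda / 2 * ((y q ^+ 2)^-1 + y q ^+ 2 * F q + y q ^+ 3 * Fy q))
  | 0%N, 1%N, 3%N =>
      lambda / 2 * (- (y q ^+ 2)^-1 + y q ^+ 2 * F q + y q ^+ 3 * Fy q)
  | 0%N, 3%N, 1%N =>
      - (lambda / 2 * (- (y q ^+ 2)^-1 + y q ^+ 2 * F q + y q ^+ 3 * Fy q))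
  | 1%N, 0%N, 3%N | 1%N, 3%N, 0%N | 1%N, 3%N, 1%N => lambda / 2
  | 1%N, 1%N, 3%N => - (lambda / 2)
  | 2%N, 2%N, 3%N => - (y q)^-1
  | 2%N, 3%N, 2%N => (y q)^-1
  | 3%N, 0%N, 1%N | 3%N, 1%N, 0%N => (y q)^-1
  | _, _, _ => 0
  end.

Lemma connection_formE i a b p : spacetime p ->
  connection_form (metric lambda F) adapted_coframe i a b p =
  connection_coef i a b (half_plane_part p).
Proof.
move=> Hp; have y0 := y_neq0 Hp.
rewrite /connection_form invmx_adapted_coframe // !sum_ord4.
rewrite !partial_adapted_coframe // !christoffelE // !mxE.
rewrite /christoffel_coef /coframe_coef_partial /coframe_coef /frame_coef
  /connection_coef.
move: (Fx _) (Fy _) (F _) (y _) y0 => fx fy f t t0.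
by elim/ord4_ind: i; elim/ord4_ind: a; elim/ord4_ind: b => /=; field;
  rewrite ?lambda0 ?t0.
Qed.

Definition adapted_bundle : spinor_bundle (@spacetime R) (metric lambda F) :=
  Build_spinor_bundle adapted_coframe_orthonormal (majorana_irreducible R).

(** Up to scale, the only spinor that gamma_0 + gamma_1 kills and on which
    gamma_3 acts as -1. *)
Definition basic_spinor : 'cV[R]_4 := delta_mx o1 0.

Lemma majorana_basic_spinor a r :
  (majorana R a *m basic_spinor) r 0 = majorana_coef R a r 1.
Proof. by rewrite /basic_spinor -colE !mxE. Qed.

Lemma majorana2_basic_spinor a b r :
  (majorana R a *m majorana R b *m basic_spinor) r 0 =
  \sum_(s < 4) majorana_coef R a r s * majorana_coef R b s 1.
Proof.
rewrite -mulmxA mxE; apply: eq_bigr => s _.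
by rewrite majorana_basic_spinor mxE.
Qed.

(** The Killing equation along d_i: the spinor is constant, so only the
    connection term of the covariant derivative remains. *)
Lemma killing_equation_coordinate i p : spacetime p ->
  4^-1 *: \sum_a \sum_b
    (Defs.eta R a a
     * connection_form (metric lambda F) adapted_coframe i a b p)
       *: (majorana R a *m majorana R b *m basic_spinor) =
  (lambda / 2) *: \sum_a (Defs.eta R a a * adapted_coframe p a i)
       *: (majorana R a *m basic_spinor).
Proof.
move=> Hp; have y0 := y_neq0 Hp; apply/colP => r.
rewrite [LHS]mxE [RHS]mxE !sum_ord4.
have ent (c : R) (v : 'cV[R]_4) s : (c *: v) s 0 = c * v s 0 by rewrite mxE.
have entD (v w : 'cV[R]_4) s : (v + w) s 0 = v s 0 + w s 0 by rewrite mxE.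
rewrite !entD !ent !majorana2_basic_spinor !majorana_basic_spinor !sum_ord4.
rewrite !connection_formE // ![adapted_coframe _ _ _]mxE !etaE.
rewrite /connection_coef /coframe_coef.
move: (Fx _) (Fy _) (F _) (y _) y0 => fx fy f t t0.
by elim/ord4_ind: i; elim/ord4_ind: r => /=; field; rewrite ?lambda0 ?t0.
Qed.

Lemma basic_spinor_killing :
  killing_spinor adapted_bundle (lambda / 2) (fun=> basic_spinor).
Proof.
split=> [s k|p X Hp]; first exact: (Ck_on_const (@open_spacetime R)).
rewrite /spinor_nabla /flat_clifford /=.
transitivity (\sum_i X 0 i *: ((lambda / 2) *:
    \sum_a (Defs.eta R a a * adapted_coframe p a i)
       *: (majorana R a *m basic_spinor))).
  apply: eq_bigr => i _; congr (_ *: _).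
  rewrite -killing_equation_coordinate //.
  rewrite [X in X + _](_ : _ = 0) ?add0r //.
  apply/colP => s; rewrite !mxE; apply: has_deriv_val.
  exact: has_deriv_const.
rewrite scaler_sumr; under eq_bigr do rewrite scaler_sumr scaler_sumr.
rewrite exchange_big /=; apply: eq_bigr => a _.
rewrite mulr_sumr scaler_suml scaler_sumr; apply: eq_bigr => i _.
by rewrite !scalerA; congr (_ *: _); ring.
Qed.

End KillingSpinor.

Theorem mainTheorem5 (R : realType) (lambda : R) (lambda0 : lambda != 0)
    (F : 'rV[R]_2 -> R) (smoothF : smooth_on (@half_plane R) F) :
  admits_nontrivial_killing_spinor (@spacetime R) (metric lambda F) (lambda / 2)
  /\ (((exists a1 a2 a3 a4 : R,
          forall q, half_plane q -> F q = rational_form a1 a2 a3 a4 q)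
       \/ (exists a1 a2 a3 a4 c : R, c != 0 /\
             forall q, half_plane q -> F q = bessel_form a1 a2 a3 a4 c q))
      -> einstein_on (@spacetime R) (metric lambda F) (- 3 * lambda ^+ 2)).
Proof.
split.
  exists (adapted_bundle lambda0 smoothF), (fun=> basic_spinor R).
  split; first exact: basic_spinor_killing.
  exists (const_mx 1); first by rewrite /spacetime /half_plane /= !mxE ltr01.
  apply/eqP => /matrixP /(_ o1 0) /eqP.
  by rewrite !mxE !eqxx oner_eq0.
move=> forms; apply: einstein_metric => //.
case: forms => [[a1 [a2 [a3 [a4 FE]]]]|[a1 [a2 [a3 [a4 [c [c0 FE]]]]]]].
  exact: einstein_equation_rational FE.
exact: einstein_equation_bessel c0 FE.
Qed.
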